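(* Let $G$ be a countable group and let $(H_n)_{n}$ be a descending chain of finite index subgroups of $G$. Then the profinite action $a^{(H_n)}$ associated to $(H_n)_n$ is weakly equivalent to the ultraproduct of the sequence of finite actions of $G$ on the quotients $G/H_n$, with respect to any non-principal ultrafilter $\mathfrak{u}$ on $\mathbf{N}$.
   Context: A probability measure preserving (pmp) action $a$ of a countable group $G$ is an action of $G$ by measure preserving automorphisms of a probability space $(\mathfrak{X}_a,\mu_a)$, not assumed to be standard. Weak containment: $a\prec b$ if for every $\varepsilon>0$, every finite measurable partition $\{A_1,\ldots,A_n\}$ of $\mathfrak{X}_a$ and every finite subset $F\subset G$ there is a measurable partition $\{B_1,\ldots,B_n\}$ of $\mathfrak{X}_b$ such that $\sum_{i,j\leq n}\sum_{f\in F}|\mu_a(A_i\cap fA_j)-\mu_b(B_i\cap fB_j)|<\varepsilon$. The actions $a$ and $b$ are weakly equivalent if $a\prec b$ and $b\prec a$. Each $G/H_n$ carries the normalized counting measure and the left translation action of $G$. The profinite action $a^{(H_n)}$ is the action of $G$ on the inverse limit $\varprojlim G/H_n$ (along the natural projections $G/H_{n+1}\to G/H_n$), equipped with the inverse limit of the normalized counting measures. Ultraproducts: given a non-principal ultrafilter $\mathfrak{u}$ on $\mathbf{N}$ and probability spaces $(\mathfrak{X}_n,\mathscr{B}_n,\mu_n)$, let $\mathfrak{X}_{\mathfrak{u}}=\prod_n\mathfrak{X}_n/\sim$, where $(x_n)\sim(y_n)$ iff $\{n:x_n=y_n\}\in\mathfrak{u}$; write $[x_n]_{\mathfrak{u}}$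 for the class of $(x_n)_n$ and $[A_n]_{\mathfrak{u}}$ for the image of $\prod_n A_n$. Let $\theta(A)=\inf\{\sum_{i\in\mathbf{N}}\lim_{n\in\mathfrak{u}}\mu_n(B^i_n): A\subset\bigcup_i[B^i_n]_{\mathfrak{u}},\ B^i_n\in\mathscr{B}_n\}$ for $A\subset\mathfrak{X}_{\mathfrak{u}}$. This is an outer measure, and the ultraproduct $(\mathfrak{X}_{\mathfrak{u}},\mathscr{B}_{\mathfrak{u}},\mu_{\mathfrak{u}})$ is the probability space obtained from $\theta$ by Carathéodory's construction; it satisfies $\mu_{\mathfrak{u}}([A_n]_{\mathfrak{u}})=\lim_{n\in\mathfrak{u}}\mu_n(A_n)$. The ultraproduct of a sequence $(a_n)_n$ of pmp actions of $G$ is the action of $G$ on the ultraproduct of the spaces $(\mathfrak{X}_{a_n},\mu_{a_n})$ given by $g[x_n]_{\mathfrak{u}}=[gx_n]_{\mathfrak{u}}$. *)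

(* Defs.v *)
From HB Require Import structures.
From mathcomp Require Import all_boot all_order all_algebra.
From mathcomp Require Import generic_quotient finmap.
From mathcomp Require Import all_classical all_reals all_analysis.

Set Implicit Arguments.
Unset Strict Implicit.
Unset Printing Implicit Defensive.
Import Order.TTheory GRing.Theory Num.Theory.

Local Open Scope classical_set_scope.
Local Open Scope quotient_scope.
Local Open Scope ring_scope.

(* No standardness assumption on the underlying probability space.  Since
   [pmp_act g] and [pmp_act g^-1] are mutually inverse, the last two fields
   say that every group element acts by a measure preserving automorphism. *)
Record pmp_action (G : groupType) (R : realType) := PmpAction {
  pmp_display : measure_display ;
  pmp_space :> measurableType pmp_display ;
  pmp_measure : probability pmp_space R ;
  pmp_act : G -> pmp_space -> pmp_space ;
  pmp_act1 : forall x, pmp_act 1%g x = x ;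
  pmp_actM : forall g h x, pmp_act (g * h)%g x = pmp_act g (pmp_act h x) ;
  pmp_act_measurable : forall g, measurable_fun setT (pmp_act g) ;
  pmp_act_preserving : forall g (A : set pmp_space), measurable A ->
    pmp_measure (pmp_act g @^-1` A) = pmp_measure A }.

(* As usual for weak containment, some of the pieces may be empty. *)
Definition measurable_partition d (T : measurableType d) n
    (A : 'I_n -> set T) : Prop :=
  [/\ forall i, measurable (A i), trivIset setT A & \bigcup_i A i = setT].

Section weak_containment.
Context (G : groupType) (R : realType).
Local Open Scope ereal_scope.

Definition weakly_contained (a b : pmp_action G R) : Prop :=
  forall (e : R), (0 < e)%R ->
  forall n (A : 'I_n -> set a), measurable_partition A ->
  forall F : {fset G},
  exists B : 'I_n -> set b, measurable_partition B /\
    \sum_(i < n) \sum_(j < n) \sum_(f <- F)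
      `| pmp_measure a (A i `&` pmp_act f @` A j)
         - pmp_measure b (B i `&` pmp_act f @` B j) | < e%:E.

Definition weakly_equivalent (a b : pmp_action G R) : Prop :=
  weakly_contained a b /\ weakly_contained b a.

End weak_containment.

Section coset_space.
Context (G : groupType) (H : groupClosed G).

Definition coset_rel : rel G := fun g h => (g^-1 * h)%g \in H.

Lemma coset_rel_refl : reflexive coset_rel.
Proof. by move=> g; rewrite /coset_rel mulVg gpred1. Qed.

Lemma coset_rel_sym : symmetric coset_rel.
Proof. by move=> g h; rewrite /coset_rel -gpredV invgM invgK. Qed.

Lemma coset_rel_trans : transitive coset_rel.
Proof.
move=> h g k gh hk; rewrite /coset_rel.
by rewrite -(mulVKg h k) mulgA gpredM.
Qed.

Canonical coset_rel_equiv :=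
  EquivRel coset_rel coset_rel_refl coset_rel_sym coset_rel_trans.

(* The set G/H of left cosets; [\pi g] is the coset gH. *)
Definition coset_space := {eq_quot coset_rel}.

HB.instance Definition _ := Choice.on coset_space.
HB.instance Definition _ := EqQuotient.on coset_space.
HB.instance Definition _ := isPointed.Build coset_space (\pi_coset_space 1%g).
HB.instance Definition _ := @isMeasurable.Build default_measure_display
  coset_space discrete_measurable discrete_measurable0
  discrete_measurableC discrete_measurableU.

Definition coset_act (g : G) (x : coset_space) : coset_space :=
  \pi_coset_space (g * repr x)%g.

Lemma coset_eqP (g h : G) :
  \pi_coset_space g = \pi_coset_space h <-> (g^-1 * h)%g \in H.
Proof. by split=> [/eqquotP //|gh]; apply/eqquotP. Qed.

Lemma coset_repr (g : G) : (g^-1 * repr (\pi_coset_space g))%g \in H.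
Proof. by apply/coset_eqP; rewrite reprK. Qed.

Lemma coset_actE (g h : G) :
  coset_act g (\pi_coset_space h) = \pi_coset_space (g * h)%g.
Proof.
apply/esym/coset_eqP.
by rewrite invgM -mulgA (mulgA g^-1%g) mulVg mul1g coset_repr.
Qed.

Lemma coset_act1 x : coset_act 1%g x = x.
Proof. by rewrite /coset_act mul1g reprK. Qed.

Lemma coset_actM g h x : coset_act (g * h)%g x = coset_act g (coset_act h x).
Proof. by rewrite [coset_act h x]/coset_act coset_actE /coset_act mulgA. Qed.

Lemma coset_act_measurable g : measurable_fun setT (coset_act g).
Proof. by []. Qed.

End coset_space.

Section coset_action.
Context (R : realType) (G : groupType) (H : groupClosed G).
Variable finH : finite_set [set: coset_space H].

Definition coset_index : nat := #|` fset_set [set: coset_space H] |.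

(* The finiteness argument makes this a probability measure canonically. *)
Definition normalized_counting of finite_set [set: coset_space H] :
    set (coset_space H) -> \bar R :=
  mscale (coset_index%:R^-1)%:nng (@counting (coset_space H) R).

HB.instance Definition _ := Measure.on (normalized_counting finH).

Lemma normalized_countingE (A : set (coset_space H)) :
  normalized_counting finH A = (#|` fset_set A |%:R / coset_index%:R)%:E.
Proof.
rewrite /normalized_counting /mscale/= /counting asboolT; last first.
  exact: sub_finite_set finH.
by rewrite -EFinM mulrC.
Qed.

Lemma coset_index_gt0 : (0 < coset_index)%N.
Proof.
rewrite /coset_index cardfs_gt0; apply/fset0Pn.
by exists point; rewrite in_fset_set// inE.
Qed.

Lemma normalized_counting_setT : normalized_counting finH setT = 1%E.
Proof.
by rewrite normalized_countingE divff// pnatr_eq0 -lt0n coset_index_gt0.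
Qed.

HB.instance Definition _ := Measure_isProbability.Build _ _ _
  (normalized_counting finH) normalized_counting_setT.

Lemma coset_act_preserving (g : G) (A : set (coset_space H)) : measurable A ->
  normalized_counting finH (coset_act g @^-1` A) = normalized_counting finH A.
Proof.
move=> _; rewrite !normalized_countingE; congr (_%:R / _)%:E.
have -> : coset_act g @^-1` A = coset_act g^-1%g @` A.
  apply/seteqP; split=> [x Ax|_ [x Ax <-]] /=.
    by exists (coset_act g x); rewrite // -coset_actM mulVg coset_act1.
  by rewrite -coset_actM mulgV coset_act1.
rewrite fset_set_image; last exact: sub_finite_set finH.
rewrite card_imfset//=; apply: (can_inj (g := coset_act g)) => x.
by rewrite -coset_actM mulgV coset_act1.
Qed.

Definition coset_action : pmp_action G R :=
  @PmpAction G R default_measure_display (coset_space H)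
    (normalized_counting finH)
    (@coset_act G H) (@coset_act1 G H) (@coset_actM G H)
    (@coset_act_measurable G H) coset_act_preserving.

End coset_action.

Section ultralimit.
Context (u : set_system nat) (uU : UltraFilter u).

Lemma ultrafilter_tail (unp : forall n, ~ u [set n]) N :
  \forall n \near u, (N <= n)%N.
Proof.
elim: N => [|N IH]; first exact: nearW.
have [uN|uN] := in_ultra_setVsetC [set N] uU.
  by case: (unp _ uN).
by apply: filterS2 IH uN => n /= Nn /eqP nN; rewrite ltn_neqAle eq_sym nN.
Qed.

Lemma ultrafilter_fmap T (f : nat -> T) : UltraFilter (f @ u).
Proof.
split=> [|F FF uF]; first exact: fmap_proper_filter.
apply/seteqP; split=> [A FA|]; last exact: uF.
have [//|uA] := in_ultra_setVsetC (f @^-1` A) uU.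
have /filter_ex[x []//] : F (A `&` ~` A) by apply: filterI FA (uF _ _).
Qed.

Lemma cvg_ultrafilter (R : realType) (f : nat -> \bar R) :
  (forall n, (0 <= f n <= 1)%E) -> cvg (f @ u).
Proof.
move=> f01.
have fE : f = EFin \o (fine \o f).
  apply/funext => n /=.
  rewrite fineK// ge0_fin_numE; last by case/andP: (f01 n).
  by apply: le_lt_trans (ltry 1); case/andP: (f01 n).
have := @segment_compact R 0 1; rewrite compact_ultra.
move=> /(_ ((fine \o f) @ u) (ultrafilter_fmap _)) /= [|l [_ fl]].
  apply: filterS filterT => n _ /=; rewrite in_itv/=.
  by have := f01 n; rewrite fE/= !lee_fin.
rewrite fE; apply/cvg_ex; exists l%:E.
by apply: cvg_EFin => //; exact: nearW.
Qed.

End ultralimit.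

Section ultra_space.
Context (u : set_system nat) (uU : UltraFilter u).
Context (d : nat -> measure_display) (X : forall n, measurableType (d n)).

Definition ultra_rel of UltraFilter u : rel (forall n, X n) :=
  fun x y => `[< \forall n \near u, x n = y n >].

Lemma ultra_rel_refl : reflexive (ultra_rel uU).
Proof. by move=> x; apply/asboolP; exact: nearW. Qed.

Lemma ultra_rel_sym : symmetric (ultra_rel uU).
Proof.
by move=> x y; apply/asboolP/asboolP; apply: filterS => n /=.
Qed.

Lemma ultra_rel_trans : transitive (ultra_rel uU).
Proof.
move=> y x z /asboolP xy /asboolP yz; apply/asboolP.
by apply: filterS2 xy yz => n /= ->.
Qed.

Canonical ultra_rel_equiv :=
  EquivRel (ultra_rel uU) ultra_rel_refl ultra_rel_sym ultra_rel_trans.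

Definition ultra_space := {eq_quot (ultra_rel uU)}.

HB.instance Definition _ := Choice.on ultra_space.
HB.instance Definition _ := EqQuotient.on ultra_space.
HB.instance Definition _ :=
  isPointed.Build ultra_space (\pi_ultra_space (fun=> point)).

Lemma ultra_eqP (x y : forall n, X n) :
  \pi_ultra_space x = \pi_ultra_space y <-> \forall n \near u, x n = y n.
Proof.
by split=> [/eqquotP/asboolP //|xy]; apply/eqquotP/asboolP.
Qed.

Lemma ultra_repr (x : forall n, X n) :
  \forall n \near u, x n = repr (\pi_ultra_space x) n.
Proof. by apply/ultra_eqP; rewrite reprK. Qed.

Definition ultra_set (A : forall n, set (X n)) : set ultra_space :=
  [set \pi_ultra_space x | x in [set x | forall n, A n (x n)]].

(* [ultra_mem A] coincides with [ultra_set A] unless some A n is empty, in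
   which case [ultra_set A] is empty as well. *)
Definition ultra_mem (A : forall n, set (X n)) : set ultra_space :=
  [set q | \forall n \near u, A n (repr q n)].

Lemma ultra_memP (A : forall n, set (X n)) (x : forall n, X n) :
  ultra_mem A (\pi_ultra_space x) <-> \forall n \near u, A n (x n).
Proof.
by split; apply: filterS2 (ultra_repr x) => n /= ->.
Qed.

Lemma ultra_set_sub A : ultra_set A `<=` ultra_mem A.
Proof. by move=> _ [x Ax <-]; apply/ultra_memP; exact: nearW. Qed.

Lemma ultra_setE A : (forall n, A n !=set0) -> ultra_set A = ultra_mem A.
Proof.
move=> A0; have a n := cid (A0 n); apply/seteqP; split.
  exact: ultra_set_sub.
move=> q Aq.
exists (fun n => if `[< A n (repr q n) >] then repr q n else projT1 (a n)).
  by move=> n /=; case: asboolP => // _; case: (a n).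
rewrite -[RHS]reprK; apply/ultra_eqP; apply: filterS Aq => n /= Aq.
by rewrite asboolT.
Qed.

Lemma ultra_memT : ultra_mem (fun=> setT) = setT.
Proof. by apply/seteqP; split=> // q _; exact: nearW. Qed.

Lemma ultra_memI A B :
  ultra_mem A `&` ultra_mem B = ultra_mem (fun n => A n `&` B n).
Proof.
apply/seteqP; split=> [q [Aq Bq]|q ABq].
  by apply: filterS2 Aq Bq.
by split; apply: filterS ABq => n [].
Qed.

Lemma ultra_memC A : ~` ultra_mem A = ultra_mem (fun n => ~` A n).
Proof.
apply/seteqP; split=> [q Aq|q nAq Aq].
  by case: (in_ultra_setVsetC [set n | A n (repr q n)] uU).
by apply: (@filter_not_empty _ u _); apply: filterS2 nAq Aq => n.
Qed.

Lemma ultra_saturation (unp : forall n, ~ u [set n]) (A : forall n, set (X n))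
    (B : nat -> forall n, set (X n)) :
  ultra_mem A `<=` \bigcup_i ultra_mem (B i) ->
  exists N, \forall n \near u, A n `<=` \bigcup_(i < N) B i n.
Proof.
move=> AB; apply: contrapT => noN.
pose bad N n := ~ (A n `<=` \bigcup_(i < N) B i n).
have ubad N : \forall n \near u, bad N n.
  have [uN|//] := in_ultra_setVsetC [set n | A n `<=` \bigcup_(i < N) B i n]
    uU.
  by exfalso; apply: noN; exists N.
have bad_le N M n : (N <= M)%N -> bad M n -> bad N n.
  move=> NM; apply: contra_not => AN x /AN[i /= iN Bix].
  by exists i => //=; exact: leq_trans NM.
have pick n : exists x : X n, forall N, (N <= n)%N -> bad N n ->
    A n x /\ forall i, (i < N)%N -> ~ B i n x.
  have [bad0|nbad0] := pselect (bad 0%N n); last first.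
    exists point => N _ /(bad_le 0%N _ _ (leq0n _)).
    by move/nbad0.
  have ex : exists k, (k <= n)%N && `[< bad k n >].
    by exists 0%N; rewrite leq0n asboolT.
  have ub k : (k <= n)%N && `[< bad k n >] -> (k <= n)%N by case/andP.
  case: (ex_maxnP ex ub) => k /andP[kn /asboolP badk] kmax.
  have [x [Ax Bx]] : exists x, A n x /\ ~ (\bigcup_(i < k) B i n) x.
    apply: contrapT => nx; apply: badk => x Ax; apply: contrapT => Bx.
    by apply: nx; exists x.
  exists x => N Nn badN; split=> // i iN Bix; apply: Bx; exists i => //=.
  by apply: leq_trans iN _; apply: kmax; rewrite Nn asboolT.
pose x n := projT1 (cid (pick n)).
have xP n N : (N <= n)%N -> bad N n ->
    A n (x n) /\ forall i, (i < N)%N -> ~ B i n (x n).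
  exact: projT2 (cid (pick n)) N.
have [|i _] := AB (\pi_ultra_space x).
  by apply/ultra_memP; apply: filterS (ubad 0%N) => n /(xP n 0%N (leq0n n))[].
move=> /ultra_memP Bx.
have tail := ultrafilter_tail uU unp i.+1.
apply: (@filter_not_empty _ u _).
apply: filterS3 Bx (ubad i.+1) tail => n Bn badn ltin.
by have [_ /(_ i (ltnSn i))] := xP n i.+1 ltin badn.
Qed.

End ultra_space.
Section ultra_measure.
Context (R : realType) (u : set_system nat) (uU : UltraFilter u).
Context (d : nat -> measure_display) (X : forall n, measurableType (d n)).
Variable mu : forall n, probability (X n) R.
Local Open Scope ereal_scope.

Definition ultra_lim (A : forall n, set (X n)) : \bar R :=
  lim (mu n (A n) @[n --> u]).

Definition ultra_cover (E : set (ultra_space uU X)) :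
    set (nat -> forall n, set (X n)) :=
  [set B | (forall i n, measurable (B i n)) /\
           E `<=` \bigcup_i ultra_set (B i)].

(* Covers in which some B i n is empty only add to the sum, so the convention
   chosen for [ultra_set] is immaterial here (see [ultra_outer_mem]). *)
Definition ultra_outer (E : set (ultra_space uU X)) : \bar R :=
  ereal_inf [set \sum_(i <oo) ultra_lim (B i) | B in ultra_cover E].

Lemma cvg_ultra_lim A : (forall n, measurable (A n)) ->
  mu n (A n) @[n --> u] --> ultra_lim A.
Proof.
move=> mA; apply: cvg_ultrafilter => n.
by rewrite measure_ge0 probability_le1.
Qed.

Lemma ultra_lim_ge0 A : (forall n, measurable (A n)) -> 0 <= ultra_lim A.
Proof.
move=> mA; apply: lime_ge; first exact: cvg_ultra_lim.
by apply: nearW => n; exact: measure_ge0.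
Qed.

Lemma ultra_lim_le1 A : (forall n, measurable (A n)) -> ultra_lim A <= 1.
Proof.
move=> mA; apply: lime_le; first exact: cvg_ultra_lim.
by apply: nearW => n; exact: probability_le1.
Qed.

Lemma ultra_lim_near A c : (\forall n \near u, mu n (A n) = c) ->
  ultra_lim A = c.
Proof. by move=> Ac; apply: lim_near_cst. Qed.

Lemma ultra_lim0 : ultra_lim (fun=> set0) = 0.
Proof. by apply: ultra_lim_near; apply: nearW => n; rewrite measure0. Qed.

Lemma ultra_limT : ultra_lim (fun=> setT) = 1.
Proof.
by apply: ultra_lim_near; apply: nearW => n; rewrite probability_setT.
Qed.

Lemma le_ultra_lim A B : (forall n, measurable (A n)) ->
  (forall n, measurable (B n)) -> (\forall n \near u, A n `<=` B n) ->
  ultra_lim A <= ultra_lim B.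
Proof.
move=> mA mB AB; apply: lee_lim; try exact: cvg_ultra_lim.
by apply: filterS AB => n AB; rewrite le_measure// inE.
Qed.

Lemma ultra_limD A B : (forall n, measurable (A n)) ->
  (forall n, measurable (B n)) -> (forall n, A n `&` B n = set0) ->
  ultra_lim (fun n => A n `|` B n) = ultra_lim A + ultra_lim B.
Proof.
move=> mA mB AB.
rewrite /ultra_lim -limeD; try exact: cvg_ultra_lim; last first.
  by apply: ge0_adde_def; rewrite inE ultra_lim_ge0.
by congr (lim (_ @ u)); apply/funext => n /=; rewrite measureU.
Qed.

Lemma ultra_limU_le A B : (forall n, measurable (A n)) ->
  (forall n, measurable (B n)) ->
  ultra_lim (fun n => A n `|` B n) <= ultra_lim A + ultra_lim B.
Proof.
move=> mA mB.
rewrite [X in ultra_lim X](_ : _ = fun n => A n `|` (B n `\` A n)).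
  rewrite ultra_limD//; last first.
  - by move=> n; rewrite setDE setIA setIC setIA setICl set0I.
  - by move=> n; exact: measurableD.
  apply: leeD => //; apply: le_ultra_lim => //.
    by move=> n; exact: measurableD.
  by apply: nearW => n; exact: subDsetl.
by apply: functional_extensionality_dep => n; rewrite setDE setUIr setUCr setIT.
Qed.

Lemma ultra_lim_bigcup_le (B : nat -> forall n, set (X n)) N :
  (forall i n, measurable (B i n)) ->
  ultra_lim (fun n => \bigcup_(i < N) B i n) <= \sum_(i < N) ultra_lim (B i).
Proof.
move=> mB; elim: N => [|N IH].
  rewrite big_ord0 -[leRHS]ultra_lim0; apply: le_ultra_lim => //.
  - by move=> n; rewrite bigcup_mkord big_ord0.
  - by apply: nearW => n; rewrite bigcup_mkord big_ord0.
rewrite big_ord_recr/=; apply: le_trans (leeD IH (lexx _)).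
rewrite [X in ultra_lim X](_ : _ = fun n => (\bigcup_(i < N) B i n) `|` B N n).
  apply: ultra_limU_le => // n; apply: bigcup_measurable => i _; exact: mB.
apply: functional_extensionality_dep => n.
by rewrite !bigcup_mkord big_ord_recr.
Qed.

Lemma ultra_series_ge0 (B : nat -> forall n, set (X n)) :
  (forall i n, measurable (B i n)) -> 0 <= \sum_(i <oo) ultra_lim (B i).
Proof. by move=> mB; apply: nneseries_ge0 => i _ _; exact: ultra_lim_ge0. Qed.

Lemma ultra_outer_ge0 E : 0 <= ultra_outer E.
Proof.
by apply: le_ereal_inf_tmp => _ [B [mB _] <-]; exact: ultra_series_ge0.
Qed.

Lemma le_ultra_outer : {homo ultra_outer : E F / E `<=` F >-> E <= F}.
Proof.
move=> E F EF; apply/ereal_inf_le_tmp => _ [B [mB BF] <-].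
by exists B => //; split => //; exact: subset_trans EF BF.
Qed.

Lemma ultra_outer_le E B : ultra_cover E B ->
  ultra_outer E <= \sum_(i <oo) ultra_lim (B i).
Proof. by move=> EB; apply: ereal_inf_lbound; exists B. Qed.

Lemma ultra_outer0 : ultra_outer set0 = 0.
Proof.
apply/eqP; rewrite eq_le ultra_outer_ge0 andbT.
apply: (@le_trans _ _ (\sum_(i <oo) ultra_lim (fun=> set0))).
  by apply: (@ultra_outer_le _ (fun _ _ => set0)); split.
by rewrite eseries0// => i _ _; exact: ultra_lim0.
Qed.

Lemma ultra_outer_sigma_subadditive : sigma_subadditive ultra_outer.
Proof.
move=> A; have [[i ioo]|] := pselect (exists i, ultra_outer (A i) = +oo).
  rewrite (eseries_pinfty _ _ ioo) ?leey// => n _.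
  by rewrite -ltNye (lt_le_trans _ (ultra_outer_ge0 _)).
rewrite -forallNE => Aoo.
suff add2e (e : {posnum R}) :
    ultra_outer (\bigcup_n A n) <= \sum_(i <oo) ultra_outer (A i) + e%:num%:E.
  by apply/lee_addgt0Pr => _/posnumP[].
rewrite (le_trans _ (epsilon_trick _ _ _))//; last first.
  by move=> n; exact: ultra_outer_ge0.
pose P n B := ultra_cover (A n) B /\
  \sum_(k <oo) ultra_lim (B k) <=
    ultra_outer (A n) + (e%:num / (2 ^ n.+1)%:R)%:E.
have [G PG] : {G : nat -> nat -> forall n, set (X n) & forall n, P n (G n)}.
  apply: (@choice _ _ P) => n; rewrite /P.
  have An : ultra_outer (A n) \is a fin_num.
    by rewrite ge0_fin_numE ?ultra_outer_ge0// ltey; exact/eqP/Aoo.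
  have en1 : (0 < e%:num / (2 ^ n.+1)%:R)%R by [].
  have [_ [B AB <-] /ltW Be] := lb_ereal_inf_adherent en1 An.
  by exists B.
have mG i j n : measurable (G i j n) by exact: (PG i).1.1.
pose muG := (fun ij : nat * nat => ultra_lim (G ij.1 ij.2)).
have muG_ge0 ij : 0 <= muG ij by exact: ultra_lim_ge0.
apply: (@le_trans _ _ (\esum_(ij in setT) muG ij)).
  have /card_esym/ppcard_eqP[f] := card_nat2.
  apply: (@le_trans _ _ (\sum_(k <oo) muG (f k))).
    apply: (@ultra_outer_le _ (fun k => G (f k).1 (f k).2)); split => //.
    move=> t [i _ /(PG i).1.2[j _ Gt]].
    by exists (f^-1%FUN (i, j)) => //=; rewrite invK ?inE.
  by rewrite -(esum_pred_image muG _ xpredT) ?[fun=> _]set_true// image_eq.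
rewrite (_ : esum _ _ = \sum_(i <oo) \sum_(j <oo) ultra_lim (G i j)).
  apply: lee_nneseries => n _; first by move=> *; exact: ultra_series_ge0.
  exact: (PG n).2.
pose J : nat -> set (nat * nat) := fun i => [set (i, j) | j in setT].
rewrite (_ : setT = \bigcup_k J k); last first.
  by rewrite predeqE => -[a b]; split => // _; exists a => //; exists b.
rewrite esum_bigcupT //=; last first.
  apply/trivIsetP => i j _ _ ij.
  rewrite predeqE => -[n m] /=; split => //= -[] [_] _ [<-{n} _].
  by move=> [m' _] [] /esym/eqP; rewrite (negbTE ij).
rewrite -(image_id [set: nat]) -fun_true esum_pred_image//; last first.
  by move=> n _; exact: esum_ge0.
apply: eq_eseriesr => /= j _.
rewrite -(esum_pred_image muG (pair j) predT)//=; last first.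
  by move=> ? ? _ _; exact: (@can_inj _ _ _ snd).
by congr esum; rewrite predeqE => -[a b]; split; move=> [i _ <-]; exists i.
Qed.

HB.instance Definition _ := isOuterMeasure.Build R (ultra_space uU X)
  ultra_outer ultra_outer0 ultra_outer_ge0 le_ultra_outer
  ultra_outer_sigma_subadditive.

Hypothesis unp : forall n, ~ u [set n].

Lemma ultra_outer_mem A : (forall n, measurable (A n)) ->
  ultra_outer (ultra_mem A) = ultra_lim A.
Proof.
move=> mA; apply/eqP; rewrite eq_le; apply/andP; split; last first.
  apply: le_ereal_inf_tmp => _ [B [mB AB] <-].
  have /(ultra_saturation unp)[N AN] :
      ultra_mem A `<=` \bigcup_i ultra_mem (B i).
    by move=> q /AB[i _ Bq]; exists i => //; exact: ultra_set_sub.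
  apply: (@le_trans _ _ (\sum_(i < N) ultra_lim (B i))).
    apply: le_trans (ultra_lim_bigcup_le _ mB); apply: le_ultra_lim => // n.
    by apply: bigcup_measurable => i _; exact: mB.
  have -> : \sum_(i < N) ultra_lim (B i) = \sum_(0 <= i < N) ultra_lim (B i).
    by rewrite big_mkord.
  by apply: nneseries_lim_ge => i _ _; exact: ultra_lim_ge0.
have [A0|A0] := in_ultra_setVsetC [set n | A n = set0] uU.
  rewrite (_ : ultra_mem A = set0) ?ultra_outer0 ?ultra_lim_ge0//.
  apply/seteqP; split=> // q Aq; apply: (@filter_not_empty _ u _).
  by apply: filterS2 A0 Aq => n /= ->.
pose A' n := if `[< A n = set0 >] then setT else A n.
have A'A : \forall n \near u, A' n = A n.
  by apply: filterS A0 => n; rewrite /A' /=; case: asboolP.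
have mA' n : measurable (A' n) by rewrite /A'; case: ifP.
have A'0 n : A' n !=set0.
  rewrite /A'; case: asboolP => [_|/eqP/set0P//].
  by exists point.
rewrite (_ : ultra_mem A = ultra_set A'); last first.
  rewrite ultra_setE//; apply/seteqP; split=> q Aq.
    by apply: filterS2 Aq A'A => n ? ->.
  by apply: filterS2 Aq A'A => n + <-.
pose B i := if i is 0%N then A' else fun=> set0.
apply: (@le_trans _ _ (\sum_(i <oo) ultra_lim (B i))).
  apply: ultra_outer_le; split; first by case=> [|i] n //=.
  by move=> q Aq; exists 0%N.
rewrite (@nneseries_split _ _ 0%N 1%N); last first.
  by case=> [|i] _; apply: ultra_lim_ge0 => n //=.
rewrite add0n big_nat1/= eseries0 ?adde0; last first.
  by case=> // i _ _; exact: ultra_lim0.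
by apply: le_ultra_lim => //; apply: filterS A'A => n ->.
Qed.

Lemma ultra_mem_caratheodory A : (forall n, measurable (A n)) ->
  ultra_outer.-caratheodory (ultra_mem A).
Proof.
move=> mA; apply: le_caratheodory_measurable => E.
apply: le_ereal_inf_tmp => _ [B [mB EB] <-].
have sub C : (forall n, measurable (C n)) ->
    ultra_outer (E `&` ultra_mem C) <=
    \sum_(i <oo) ultra_lim (fun n => B i n `&` C n).
  move=> mC.
  apply: (@le_trans _ _ (\sum_(i <oo)
      ultra_outer (ultra_mem (fun n => B i n `&` C n)))).
    apply: le_trans (outer_measure_sigma_subadditive ultra_outer _).
    apply: le_ultra_outer => q [/EB[i _ Bq] Cq]; exists i => //.
    by rewrite -ultra_memI; split=> //; exact: ultra_set_sub.
  apply: lee_nneseries => i _; first by move=> *; exact: ultra_outer_ge0.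
  by rewrite ultra_outer_mem// => n; exact: measurableI.
rewrite ultra_memC; apply: le_trans (leeD (sub _ mA) (sub _ _)) _.
  by move=> n; exact: measurableC.
rewrite -nneseriesD; last 2 first.
- by move=> i _ _; apply: ultra_lim_ge0 => n; exact: measurableI.
- move=> i _ _; apply: ultra_lim_ge0 => n.
  by apply: measurableI => //; exact: measurableC.
apply: lee_nneseries => i _.
  move=> _; apply: adde_ge0; apply: ultra_lim_ge0 => n.
    exact: measurableI.
  by apply: measurableI => //; exact: measurableC.
rewrite -ultra_limD.
- apply: le_ultra_lim => // [n|].
    by rewrite -setIUr setUCr setIT.
  by apply: nearW => n; rewrite -setIUr setUCr setIT.
- by move=> n; exact: measurableI.
- by move=> n; apply: measurableI => //; exact: measurableC.
- by move=> n; rewrite setIACA setICr setI0.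
Qed.

Lemma ultra_outer_setT : ultra_outer setT = 1.
Proof. by rewrite -(ultra_memT uU X) ultra_outer_mem// ultra_limT. Qed.

(* The non-principality argument is used, through countable saturation, to
   see canonically that the total mass is 1. *)
Definition ultra_measure of (forall n, ~ u [set n]) :
  set (caratheodory_type ultra_outer) -> \bar R := ultra_outer.

HB.instance Definition _ := isMeasure.Build _ _ _ (ultra_measure unp)
  (@caratheodory_measure0 R _ ultra_outer)
  (@caratheodory_measure_ge0 R _ ultra_outer)
  (@caratheodory_measure_sigma_additive R _ ultra_outer).
HB.instance Definition _ := Measure_isProbability.Build _ _ _
  (ultra_measure unp) ultra_outer_setT.

End ultra_measure.

Section pmp_action_theory.
Context (G : groupType) (R : realType) (a : pmp_action G R).

Lemma pmp_actK g : cancel (@pmp_act G R a g) (pmp_act g^-1%g).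
Proof. by move=> x; rewrite -pmp_actM mulVg pmp_act1. Qed.

Lemma pmp_actVK g : cancel (@pmp_act G R a g^-1%g) (pmp_act g).
Proof. by move=> x; rewrite -pmp_actM mulgV pmp_act1. Qed.

End pmp_action_theory.

Section ultraproduct.
Context (G : groupType) (R : realType) (u : set_system nat).
Context (uU : UltraFilter u) (unp : forall n, ~ u [set n]).
Variable a : nat -> pmp_action G R.

Let X n : measurableType (pmp_display (a n)) := a n.
Let mu n : probability (X n) R := pmp_measure (a n).
Let U := ultra_space uU X.

Definition ultra_act (g : G) (q : ultra_space uU X) : ultra_space uU X :=
  \pi_(ultra_space uU X) (fun n => pmp_act g (repr q n)).

Lemma ultra_actE g (x : forall n, X n) :
  ultra_act g (\pi_U x) = \pi_U (fun n => pmp_act g (x n)).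
Proof. by apply/ultra_eqP; apply: filterS (ultra_repr uU x) => n /= ->. Qed.

Lemma ultra_act1 q : ultra_act 1%g q = q.
Proof.
rewrite -[q]reprK ultra_actE; apply/ultra_eqP.
by apply: nearW => n; rewrite pmp_act1.
Qed.

Lemma ultra_actM g h q : ultra_act (g * h)%g q = ultra_act g (ultra_act h q).
Proof.
rewrite -[q]reprK ultra_actE [ultra_act h _]ultra_actE ultra_actE.
apply/ultra_eqP.
by apply: nearW => n; rewrite pmp_actM.
Qed.

Lemma ultra_actVK g : cancel (ultra_act g^-1%g) (ultra_act g).
Proof. by move=> x; rewrite -ultra_actM mulgV ultra_act1. Qed.

Lemma ultra_actK g : cancel (ultra_act g) (ultra_act g^-1%g).
Proof. by move=> x; rewrite -ultra_actM mulVg ultra_act1. Qed.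

Lemma ultra_act_preimageK g (E : set (ultra_space uU X)) :
  ultra_act g^-1%g @^-1` (ultra_act g @^-1` E) = E.
Proof. by apply/seteqP; split=> x /=; rewrite ultra_actVK. Qed.

Lemma ultra_outer_act_le g (E : set (ultra_space uU X)) :
  (ultra_outer mu (ultra_act g @^-1` E) <= ultra_outer mu E)%E.
Proof.
apply: le_ereal_inf_tmp => _ [B [mB EB] <-].
pose B' i n := @pmp_act G R (a n) g @^-1` B i n.
have mB' i n : measurable (B' i n).
  by rewrite -[B' i n]setTI; apply: pmp_act_measurable.
rewrite (_ : limn _ = \sum_(i <oo) ultra_lim u mu (B' i))%E.
  apply: ultra_outer_le; split=> // q /EB[i _ [x Bx xq]]; exists i => //.
  exists (fun n => pmp_act g^-1%g (x n)).
    by move=> n; rewrite /B'/= pmp_actVK; exact: Bx.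
  by rewrite -ultra_actE xq ultra_actK.
apply: eq_eseriesr => i _; rewrite /ultra_lim; congr (lim (_ @ u)).
by apply/funext => n /=; rewrite pmp_act_preserving.
Qed.

Lemma ultra_outer_act g (E : set (ultra_space uU X)) :
  ultra_outer mu (ultra_act g @^-1` E) = ultra_outer mu E.
Proof.
apply/eqP; rewrite eq_le ultra_outer_act_le/=.
by rewrite -{1}(ultra_act_preimageK g E) ultra_outer_act_le.
Qed.

Let UM := caratheodory_type (ultra_outer mu : set (ultra_space uU X) -> \bar R).

Lemma ultra_act_measurable g :
  measurable_fun [set: UM] (ultra_act g : UM -> UM).
Proof.
move=> _ E mE; rewrite setTI.
suff : (ultra_outer mu).-caratheodory (ultra_act g @^-1` E) by [].
have {}mE : (ultra_outer mu).-caratheodory E by [].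
move=> Y.
have := mE (ultra_act g^-1%g @^-1` Y); rewrite ultra_outer_act => ->.
rewrite -(ultra_outer_act g^-1%g (Y `&` _)).
rewrite -(ultra_outer_act g^-1%g (Y `&` ~` _)).
by rewrite !preimage_setI -preimage_setC ultra_act_preimageK.
Qed.

Definition ultraproduct : pmp_action G R :=
  @PmpAction G R _ UM (ultra_measure (mu := mu) unp)
    ultra_act ultra_act1 ultra_actM ultra_act_measurable
    (fun g E _ => ultra_outer_act g E).

End ultraproduct.

Section ultrafilter_existence.

Lemma exists_nonprincipal_ultrafilter :
  exists u : set_system nat, UltraFilter u /\ forall n, ~ u [set n].
Proof.
have [u [uU ou]] := ultraFilterLemma (eventually_filter : ProperFilter \oo).
exists u; split => // n un; apply: (@filter_not_empty _ u _).
have : u [set m | (n < m)%N] by apply: ou; exact: nbhs_infty_gt.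
by apply: filterS2 un => m /= ->; rewrite ltnn.
Qed.

Lemma ultrafilter_finite (u : set_system nat) (uU : UltraFilter u)
    (T : choiceType) (f : nat -> T) : finite_set [set: T] ->
  exists c, \forall n \near u, f n = c.
Proof.
move=> finT; apply: contrapT => nc; apply: (@filter_not_empty _ u _).
have : u (\bigcap_(c in [set` fset_set [set: T]]) [set n | f n <> c]).
  apply: filter_bigI => c _.
  have [fc|//] := in_ultra_setVsetC [set n | f n = c] uU.
  by case: nc; exists c.
apply: filterS => n /(_ (f n)) /=; rewrite in_fset_set// inE => /(_ I).
by apply.
Qed.

End ultrafilter_existence.

Section coset_projection.
Context (G : groupType) (K H : groupClosed G).

(* The natural projection G/K -> G/H, meaningful when K is contained in H. *)
Definition coset_projection (x : coset_space K) : coset_space H :=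
  \pi_(coset_space H) (repr x).

Hypothesis KH : {subset K <= H}.

Lemma coset_projectionE g : coset_projection (\pi g) = \pi_(coset_space H) g.
Proof. by apply/esym/coset_eqP/KH; exact: coset_repr. Qed.

Lemma coset_projection_act g x :
  coset_projection (coset_act g x) = coset_act g (coset_projection x).
Proof. by rewrite -[x]reprK coset_actE !coset_projectionE coset_actE. Qed.

Lemma normalized_counting_projection (R : realType)
    (finK : finite_set [set: coset_space K])
    (finH : finite_set [set: coset_space H]) (A : set (coset_space H)) :
  normalized_counting R finK (coset_projection @^-1` A) =
  normalized_counting R finH A.
Proof.
pose k := normalized_counting R finK (coset_projection @^-1` [set point]).
have kE c : normalized_counting R finK (coset_projection @^-1` [set c]) = k.
  rewrite -[c]reprK -(coset_act_preserving R finK (repr c))//.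
  congr (normalized_counting R finK _); apply/seteqP.
  have -> : \pi_(coset_space H) (repr c) = coset_act (repr c) point.
    by rewrite coset_actE mulg1.
  split=> x /=; rewrite coset_projection_act.
    move=> /(congr1 (coset_act (repr c)^-1%g)).
    by rewrite -!coset_actM mulVg !coset_act1.
  by move=> ->.
have AE (B : set (coset_space H)) :
    normalized_counting R finK (coset_projection @^-1` B) =
    (#|` fset_set B |%:R * fine k)%:E.
  have finB : finite_set B by exact: sub_finite_set finH.
  have -> : coset_projection @^-1` B =
      \bigcup_(c in B) (coset_projection @^-1` [set c]).
    apply/seteqP; split=> [x Bx|x [c Bc /= ->]]//.
    by exists (coset_projection x).
  rewrite measure_fin_bigcup//; last first.
    apply/trivIsetP => i j _ _ ij; rewrite -subset0 => x [/= -> /eqP].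
    by rewrite (negbTE ij).
  rewrite (eq_fsbigr (fun=> k)); last by move=> c _; exact: kE.
  have <- : (fine k)%:E = k by rewrite fineK// fin_num_measure.
  rewrite fsbig_finite//= sumEFin big_const_seq count_predT iter_addr_0.
  by rewrite mulr_natl.
rewrite AE normalized_countingE.
have := AE setT; rewrite preimage_setT normalized_counting_setT => -[].
have := coset_index_gt0 finH; rewrite /coset_index.
move: (#|` _ |) => N N0 kN; congr (_ * _)%:E.
apply: (@mulfI _ N%:R); rewrite ?pnatr_eq0 -?lt0n//.
by rewrite -kN divff// pnatr_eq0 -lt0n.
Qed.

End coset_projection.

Section inverse_limit.
Context (G : groupType) (H : nat -> groupClosed G).

Definition compatible (x : forall n, coset_space (H n)) : Prop :=
  forall n, coset_projection (H n) (x n.+1) = x n.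

Definition inverse_limit of (forall n, {subset H n.+1 <= H n}) :=
  {x : forall n, coset_space (H n) | compatible x}.

Variable decH : forall n, {subset H n.+1 <= H n}.

Lemma chain_subset m n : (m <= n)%N -> {subset H n <= H m}.
Proof.
elim: n => [|n IH]; first by rewrite leqn0 => /eqP ->.
rewrite leq_eqVlt => /orP[/eqP -> //|/IH nm g /decH]; exact: nm.
Qed.

Definition limit_coord n (x : inverse_limit decH) : coset_space (H n) :=
  sval x n.

Lemma limit_coord_projection n x :
  coset_projection (H n) (limit_coord n.+1 x) = limit_coord n x.
Proof. exact: (proj2_sig x n). Qed.

Lemma limit_coord_projection_le m n x : (m <= n)%N ->
  coset_projection (H m) (limit_coord n x) = limit_coord m x.
Proof.
elim: n => [|n IH] mn.
  move: mn; rewrite leqn0 => /eqP ->.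
  by rewrite /coset_projection reprK.
move: mn; rewrite leq_eqVlt => /orP[/eqP <-|mn].
  by rewrite /coset_projection reprK.
have {}mn : (m <= n)%N := mn.
rewrite -(IH mn) -(limit_coord_projection n x) -[limit_coord n.+1 x]reprK.
rewrite (coset_projectionE (@decH n)) (coset_projectionE (chain_subset mn)).
by rewrite (coset_projectionE (chain_subset (leqW mn))).
Qed.

Lemma limit_coord_inj (x y : inverse_limit decH) :
  (forall n, limit_coord n x = limit_coord n y) -> x = y.
Proof.
move: x y => [x xc] [y yc] xy; apply: eq_exist.
by apply: functional_extensionality_dep => n; exact: xy.
Qed.

Definition inverse_limit1 : inverse_limit decH :=
  exist compatible (fun n => \pi_(coset_space (H n)) 1%g)
    (fun n => coset_projectionE (@decH n) 1%g).

HB.instance Definition _ := gen_eqMixin (inverse_limit decH).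
HB.instance Definition _ := gen_choiceMixin (inverse_limit decH).
HB.instance Definition _ := isPointed.Build (inverse_limit decH) inverse_limit1.

Definition cylinder : set (set (inverse_limit decH)) :=
  [set A | exists n (B : set (coset_space (H n))), A = limit_coord n @^-1` B].

Definition limit_measurable := g_sigma_algebraType cylinder.

Lemma cylinderI : setI_closed cylinder.
Proof.
move=> _ _ [m [A ->]] [n [B ->]].
have cyl k l C : (k <= l)%N -> @limit_coord k @^-1` C =
    @limit_coord l @^-1` (coset_projection (H k) @^-1` C).
  by move=> kl; apply/seteqP; split=> x /=; rewrite limit_coord_projection_le.
exists (maxn m n).
rewrite (cyl _ _ A (leq_maxl m n)) (cyl _ _ B (leq_maxr m n)).
by rewrite -preimage_setI; eexists.
Qed.

Context (R : realType).
Hypothesis finH : forall n, finite_set [set: coset_space (H n)].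

Definition limit_marginals (mu : probability (limit_measurable) R) : Prop :=
  forall n (B : set (coset_space (H n))),
    mu (limit_coord n @^-1` B) = normalized_counting R (finH n) B.

Lemma limit_marginals_unique mu nu :
  limit_marginals mu -> limit_marginals nu ->
  forall A, measurable A -> mu A = nu A.
Proof.
move=> muH nuH A mA.
apply: (@measure_unique _ R limit_measurable cylinder (fun=> setT)) => //.
- exact: cylinderI.
- by move=> n; exists 0%N, setT; rewrite preimage_setT.
- by rewrite bigcup_const//; exists 0%N.
- by move=> _ [n [B ->]]; exact: etrans (muH n B) (esym (nuH n B)).
- by move=> n; rewrite [X in (X < _)%E]probability_setT ltry.
Qed.

Lemma exists_limit_marginals :
  exists mu : probability limit_measurable R, limit_marginals mu.
Proof.
have [u [uU unp]] := exists_nonprincipal_ultrafilter.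
pose X n : measurableType default_measure_display := coset_space (H n).
pose nu n : probability (X n) R := normalized_counting R (finH n).
pose U := caratheodory_type (ultra_outer nu : set (ultra_space uU X) -> \bar R).
have lim_ex (q : ultra_space uU X) m : exists c,
    \forall n \near u, coset_projection (H m) (repr q n) = c.
  exact: (ultrafilter_finite uU
    (fun n => coset_projection (H m) (repr q n)) (finH m)).
pose c q m := projT1 (cid (lim_ex q m)).
have cP q m : \forall n \near u, coset_projection (H m) (repr q n) = c q m.
  exact: projT2 (cid (lim_ex q m)).
have c_compat q m : coset_projection (H m) (c q m.+1) = c q m.
  apply: contrapT => ncm; apply: (@filter_not_empty _ u _).
  apply: filterS3 (cP q m) (cP q m.+1) (ultrafilter_tail uU unp m.+1).
  move=> n /= cm cm1 mn; apply: ncm; rewrite -cm -cm1.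
  rewrite -[repr q n]reprK (coset_projectionE (chain_subset mn)).
  rewrite (coset_projectionE (@decH m)).
  by rewrite (coset_projectionE (chain_subset (ltnW mn))).
pose phi (q : U) : limit_measurable := exist compatible (c q) (c_compat q).
have phiE m B : phi @^-1` (limit_coord m @^-1` B) =
    ultra_mem (fun n => coset_projection (H m) @^-1` B).
  apply/seteqP; split=> q /=.
    by move=> Bc; apply: filterS (cP q m) => n /= ->.
  move=> Bq; apply: contrapT => nBq; apply: (@filter_not_empty _ u _).
  by apply: filterS2 Bq (cP q m) => n /= + cm; rewrite cm.
have mphi : measurable_fun [set: U] phi.
  apply: (measurability (rT := limit_measurable) cylinder) => //.
  move=> _ [_ [m [B ->]] <-].
  by rewrite setTI phiE; apply: ultra_mem_caratheodory.
pose Phi : {mfun U >-> limit_measurable} :=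
  HB.pack phi (isMeasurableFun.Build _ _ _ _ phi mphi).
exists (distribution (ultra_measure (mu := nu) unp) Phi) => m B.
rewrite /distribution/= /pushforward/= phiE /ultra_measure ultra_outer_mem//.
apply: ultra_lim_near; apply: filterS (ultrafilter_tail uU unp m) => n mn.
exact: (normalized_counting_projection (chain_subset mn)).
Qed.

(* The inverse limit of the normalized counting measures, i.e. the measure
   determined by its marginals (see [limit_marginals_unique]). *)
Definition limit_measure : probability limit_measurable R :=
  projT1 (cid exists_limit_marginals).

Lemma limit_measureE : limit_marginals limit_measure.
Proof. exact: projT2 (cid exists_limit_marginals). Qed.

Lemma limit_act_subproof (g : G) (x : inverse_limit decH) :
  compatible (fun n => coset_act g (limit_coord n x)).
Proof. by move=> n; rewrite coset_projection_act// limit_coord_projection. Qed.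

Definition limit_act (g : G) (x : inverse_limit decH) : inverse_limit decH :=
  exist compatible (fun n => coset_act g (limit_coord n x))
    (limit_act_subproof g x).

Lemma limit_act1 x : limit_act 1%g x = x.
Proof. by apply: limit_coord_inj => n; exact: coset_act1. Qed.

Lemma limit_actM g h x : limit_act (g * h)%g x = limit_act g (limit_act h x).
Proof. by apply: limit_coord_inj => n; exact: coset_actM. Qed.

Lemma limit_act_measurable g :
  measurable_fun setT (limit_act g : limit_measurable -> limit_measurable).
Proof.
apply: (measurability (rT := limit_measurable) cylinder) => //.
move=> _ [_ [n [B ->]] <-]; rewrite setTI.
by apply: sub_sigma_algebra; exists n, (coset_act g @^-1` B).
Qed.

Lemma limit_act_preserving g (A : set limit_measurable) : measurable A ->
  limit_measure (limit_act g @^-1` A) = limit_measure A.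
Proof.
pose g' : {mfun limit_measurable >-> limit_measurable} :=
  HB.pack (limit_act g : limit_measurable -> limit_measurable)
    (isMeasurableFun.Build _ _ limit_measurable limit_measurable
      (limit_act g) (limit_act_measurable g)).
move: A; apply: (@limit_marginals_unique (distribution limit_measure g')).
  move=> n B; rewrite -(coset_act_preserving R (finH n) g)//.
  by rewrite -limit_measureE.
exact: limit_measureE.
Qed.

Definition profinite_action : pmp_action G R :=
  @PmpAction G R _ limit_measurable limit_measure
    limit_act limit_act1 limit_actM limit_act_measurable limit_act_preserving.

End inverse_limit.

(* Main.v *)
(* Factor maps give weak containment of the factor in the extension, with exact
   equality of correlations.  The ultraproduct factors onto the inverse limit:
   a point [x_n]_u goes to the thread whose m-th coordinate is the u-limit of
   the projections of the x_n (n >= m) to the finite set G/H_m.  Conversely, a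
   measurable partition of the ultraproduct is approximated by an internal one,
   whose correlations are u-limits of correlations in the G/H_n; so some single
   G/H_n nearly realizes them, and G/H_n is a factor of the inverse limit. *)
Require Import Defs.
From HB Require Import structures.
From mathcomp Require Import all_boot all_order all_algebra.
From mathcomp Require Import generic_quotient finmap lra.
From mathcomp Require Import all_classical all_reals all_analysis.

Set Implicit Arguments.
Unset Strict Implicit.
Unset Printing Implicit Defensive.
Import Order.TTheory GRing.Theory Num.Theory.

Local Open Scope classical_set_scope.
Local Open Scope quotient_scope.

(** * Membership patterns and measure estimates for finite families *)

Section finite_families.
Local Open Scope ereal_scope.

(** Only finitely many membership patterns occur, and the points with a given one form a finite
    intersection of sets [C k] and complements. *)
Lemma measurable_fin_preimage d (T : measurableType d) (J : finType)
    (C : J -> set T) (P : set {ffun J -> bool}) :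
  (forall k, measurable (C k)) ->
  measurable [set x | P [ffun k => `[< C k x >]]].
Proof.
move=> mC.
rewrite (_ : [set _ | _] = \bigcup_(S in P) \bigcap_k
    (if (S : {ffun J -> bool}) k then C k else ~` C k)).
  apply: fin_bigcup_measurable => [|S _]; first exact: finite_finset.
  apply: fin_bigcap_measurable => [|k _]; first exact: finite_finset.
  by case: ifP => // _; exact: measurableC.
apply/seteqP; split=> [x Px|x [S PS Sx]] /=.
  exists [ffun k => `[< C k x >]] => // k _; rewrite ffunE.
  by case: asboolP.
rewrite (_ : [ffun _ => _] = S)//; apply/ffunP => k; rewrite ffunE.
have := Sx k I; case: (S k) => Ck; first exact: asboolT.
exact: asboolF.
Qed.

Lemma measure_fin_subadditive d (R : realType) (T : measurableType d)
    (J : finType) (nu : measure T R) (F : J -> set T) :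
  (forall k, measurable (F k)) -> nu (\bigcup_k F k) <= \sum_k nu (F k).
Proof.
move=> mF.
have -> : \bigcup_k F k = \big[setU/set0]_(k : J) F k.
  rewrite -big_enum -bigcup_seq; congr bigcup.
  by apply/seteqP; split=> k //= _; rewrite mem_enum.
suff [] : measurable (\big[setU/set0]_(k : J) F k) /\
    nu (\big[setU/set0]_(k : J) F k) <= \sum_k nu (F k) by [].
elim/big_ind2 : _ => [|A x B y [mA Ax] [mB By]|k _].
- by rewrite measure0.
- split; first exact: measurableU.
  by apply: le_trans (measureU2 _ mA mB) _; exact: leeD.
- by [].
Qed.

Lemma measure_dist_le d (R : realType) (T : measurableType d)
    (nu : probability T R) (P Q N : set T) :
  measurable P -> measurable Q -> measurable N ->
  (forall x, ~ N x -> (P x <-> Q x)) -> `| nu P - nu Q | <= nu N.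
Proof.
move=> mP mQ mN PQN.
have half (A B : set T) : measurable A -> measurable B ->
    (forall x, ~ N x -> A x -> B x) -> nu A <= nu B + nu N.
  move=> mA mB AB; apply: le_trans (measureU2 _ mB mN).
  rewrite le_measure ?inE//; first exact: measurableU.
  by move=> x Ax; have [Nx|Nx] := pselect (N x); [right|left; exact: AB].
have := half P Q mP mQ (fun x Nx => (PQN x Nx).1).
have := half Q P mQ mP (fun x Nx => (PQN x Nx).2).
rewrite -(fineK (fin_num_measure nu P mP)) -(fineK (fin_num_measure nu Q mQ)).
rewrite -(fineK (fin_num_measure nu N mN)) -!EFinD abse_EFin !lee_fin.
by move=> QP PQ; rewrite ler_norml; apply/andP; split; lra.
Qed.

End finite_families.

(** * Factor maps and weak containment *)

Section factor_maps.
Context (G : groupType) (R : realType).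

(** Correlations are stated with images, while measurability and invariance of the action are stated
    with preimages; this links the two. *)
Lemma image_pmp_act (a : pmp_action G R) g (A : set a) :
  pmp_act g @` A = pmp_act g^-1%g @^-1` A.
Proof.
apply/seteqP; split=> [_ [x Ax <-]|x Ax] /=; first by rewrite pmp_actK.
by exists (pmp_act g^-1%g x); rewrite ?pmp_actVK.
Qed.

Lemma measurable_image_pmp_act (a : pmp_action G R) g (A : set a) :
  measurable A -> measurable (pmp_act g @` A).
Proof.
move=> mA; rewrite image_pmp_act -[X in measurable X]setTI.
exact: pmp_act_measurable.
Qed.

Lemma measure_image_pmp_act (a : pmp_action G R) g (A : set a) :
  measurable A -> pmp_measure a (pmp_act g @` A) = pmp_measure a A.
Proof. by move=> mA; rewrite image_pmp_act pmp_act_preserving. Qed.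

Definition factor_map (a b : pmp_action G R) (phi : a -> b) : Prop :=
  [/\ measurable_fun setT phi,
      forall g x, phi (pmp_act g x) = pmp_act g (phi x)
    & forall A, measurable A ->
        pmp_measure a (phi @^-1` A) = pmp_measure b A].

Context (a b : pmp_action G R) (phi : a -> b) (fphi : factor_map phi).

Lemma factor_partition n (A : 'I_n -> set b) :
  measurable_partition A -> measurable_partition (fun i => phi @^-1` A i).
Proof.
case: fphi => mphi _ _ [mA tA cA]; split=> [i||].
- by rewrite -[X in measurable X]setTI; exact: mphi.
- by move=> i j _ _ [x Ax]; apply: tA => //; exists (phi x).
- by rewrite -preimage_bigcup cA preimage_setT.
Qed.

(** By equivariance, the set on the left is the [phi]-preimage of the set on the right. *)
Lemma factor_correlation (A B : set b) g : measurable A -> measurable B ->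
  pmp_measure a (phi @^-1` A `&` pmp_act g @` (phi @^-1` B)) =
  pmp_measure b (A `&` pmp_act g @` B).
Proof.
case: fphi => _ ephi pphi mA mB; rewrite -pphi; last first.
  by apply: measurableI => //; exact: measurable_image_pmp_act.
congr (pmp_measure a _); rewrite !image_pmp_act.
by apply/seteqP; split=> x /=; rewrite ephi.
Qed.

Lemma factor_weakly_contained : weakly_contained b a.
Proof.
move=> e e0 n A pA F; exists (fun i => phi @^-1` A i); split.
  exact: factor_partition.
case: pA => mA _ _.
rewrite big1 ?lte_fin// => i _; rewrite big1// => j _; rewrite big1// => f _.
by rewrite factor_correlation// subee ?abse0// fin_num_measure//;
  apply: measurableI => //; exact: measurable_image_pmp_act.
Qed.

End factor_maps.

(** * Internal approximation of measurable sets and partitions *)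

Section internal_approximation.
Context (R : realType) (u : set_system nat) (uU : UltraFilter u).
Context (unp : forall n, ~ u [set n]).
Context (d : nat -> measure_display) (X : forall n, measurableType (d n)).
Variable mu : forall n, probability (X n) R.

Let U := caratheodory_type (ultra_outer mu : set (ultra_space uU X) -> \bar R).
Let m : probability U R := ultra_measure (mu := mu) unp.
Local Open Scope ereal_scope.

Lemma measurable_ultra_mem (A : forall n, set (X n)) :
  (forall n, measurable (A n)) -> measurable (ultra_mem A : set U).
Proof. by move=> mA; apply: ultra_mem_caratheodory. Qed.

(** A nearly optimal internal cover of [E] has finite subunions that are again internal; by
    continuity from below, one of them nearly exhausts their union [V], which itself exceeds [E] by
    little. *)
Lemma ultra_measure_approx (E : set U) (e : R) : measurable E -> (0 < e)%R ->
  exists A : forall n, set (X n),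
    (forall n, measurable (A n)) /\ m (E `+` (ultra_mem A : set U)) <= e%:E.
Proof.
move=> mE e0.
have e20 : (0 < e / 2)%R by rewrite divr_gt0.
have Efin : ultra_outer mu E \is a fin_num by exact: (fin_num_measure m E mE).
have [_ [B [mB EB] <-] /ltW Be] := lb_ereal_inf_adherent e20 Efin.
pose A N n := \bigcup_(i < N) B i n.
pose W N : set U := ultra_mem (A N).
have mA N n : measurable (A N n) by apply: bigcup_measurable => i _; exact: mB.
have mW N : measurable (W N) by exact: measurable_ultra_mem.
pose V := \bigcup_N W N.
have mV : measurable V by exact: bigcup_measurable.
have EV : E `<=` V.
  (* The successor is needed because [A N] collects the indices strictly below [N]. *)
  move=> q /EB[i _ /ultra_set_sub Bq]; exists i.+1 => //.
  by apply: filterS Bq => n Bn; exists i => /=.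
have Wcvg : m (W N) @[N --> \oo] --> m V.
  apply: (nondecreasing_cvg_mu mW mV) => M N MN; apply/subsetPset => q.
  by apply: filterS => n [i /= iM Bi]; exists i => //=; exact: leq_trans MN.
have WB N : m (W N) <= ultra_outer mu E + (e / 2)%:E.
  apply: le_trans Be; rewrite /m/= /ultra_measure ultra_outer_mem//.
  apply: (le_trans (ultra_lim_bigcup_le uU mu N mB)).
  rewrite -(big_mkord xpredT (fun i => ultra_lim u mu (B i))).
  by apply: nneseries_lim_ge => i _ _; exact: ultra_lim_ge0.
have VB : m V <= m E + (e / 2)%:E.
  rewrite -(cvg_lim _ Wcvg)//; apply: lime_le; first exact: cvgP Wcvg.
  exact: nearW.
have [N VN] : exists N, m V <= m (W N) + (e / 2)%:E.
  apply: contrapT => /forallNP nV.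
  have : m V <= m V - (e / 2)%:E.
    rewrite -{1}(cvg_lim _ Wcvg)//; apply: lime_le; first exact: cvgP Wcvg.
    apply: nearW => N; rewrite leeBrDr//.
    by apply/ltW; rewrite ltNge; exact/negP.
  by rewrite leNgt lteBlDr// lteDl ?lte_fin ?e20// fin_num_measure.
exists (A N); split=> //.
have WV : W N `<=` V by exact: bigcup_sup.
(* [V] contains both [E] and [W N]; each of the two differences has measure at most [e / 2]. *)
apply: (@le_trans _ _ (m ((V `\` W N) `|` (V `\` E)))).
  apply: le_measure; rewrite ?inE; last by apply: setUSS; exact: setSD.
    by apply: measurableU; apply: measurableD => //; exact: mW.
  by apply: measurableU; apply: measurableD => //; exact: mW.
apply: le_trans (measureU2 _ _ _) _; try exact: measurableD.
rewrite (splitr e) EFinD; apply: leeD.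
  rewrite measureD// ?(setIidr WV) ?leeBlDl ?fin_num_measure//.
  by rewrite (le_lt_trans (probability_le1 _ _))// ltry.
rewrite measureD// ?(setIidr EV) ?leeBlDl ?fin_num_measure//.
by rewrite (le_lt_trans (probability_le1 _ _))// ltry.
Qed.

(* Off a set of small measure, a point lies in exactly one of the internal sets
   approximating the pieces; sending a point to the first such set containing
   it, and to an arbitrary index if there is none, gives an internal partition. *)
Lemma ultra_partition_approx k (A : 'I_k -> set U) (e : R) :
  measurable_partition A -> (0 < e)%R ->
  exists B : 'I_k -> forall n, set (X n),
    (forall n, measurable_partition (fun i => B i n)) /\
    exists N : set U, [/\ measurable N, m N <= e%:E
      & forall i q, ~ N q -> (A i q <-> ultra_mem (B i) q)].
Proof.
move=> [mA tA cA] e0.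
(* The space is pointed, so the partition has at least one index; it serves as the default value and
   makes [k] positive. *)
have [i0 _] : exists i : 'I_k, True.
  have : [set: U] point by [].
  by rewrite -cA => -[i _ _]; exists i.
have k0 : (0 < k%:R :> R)%R by rewrite ltr0n; exact: leq_ltn_trans (ltn_ord i0).
have ek0 : (0 < e / k%:R)%R by rewrite divr_gt0.
have [C CP] := choice (fun i => ultra_measure_approx (mA i) ek0).
have mC i n : measurable (C i n) by have [] := CP i.
pose g (S : {ffun 'I_k -> bool}) := odflt i0 [pick i | S i].
pose f n (x : X n) := g [ffun j => `[< C j n x >]].
exists (fun i n => [set x | f n x = i]); split.
  move=> n; split.
  - by move=> i; exact: (measurable_fin_preimage [set S | g S = i]).
  - by move=> i j _ _ [x [<- <-]].
  - by apply/seteqP; split=> // x _; exists (f n x).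
(* The exceptional set is a union of [k] errors of measure at most [e / k] each. *)
exists (\bigcup_i (A i `+` (ultra_mem (C i) : set U))).
have mY i : measurable (A i `+` (ultra_mem (C i) : set U)).
  have mCi : measurable (ultra_mem (C i) : set U).
    exact: (measurable_ultra_mem (mC i)).
  by apply: measurableU; apply: measurableD => //; exact: mCi.
split.
- by apply: fin_bigcup_measurable => //; exact: finite_finset.
- apply: le_trans (measure_fin_subadditive m mY) _.
  apply: (@le_trans _ _ (\sum_(i < k) (e / k%:R)%:E)).
    by apply: lee_sum => i _; have [] := CP i.
  rewrite sumEFin sumr_const card_ord -[X in X%:E]mulr_natr divfK//.
  exact: lt0r_neq0.
- move=> i q Nq.
  have AC j : A j q <-> ultra_mem (C j) q.
    split=> H; apply: contrapT => nH; apply: Nq; exists j => //.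
      by left.
    by right.
  have [j _ Aj] : (\bigcup_i A i) q by rewrite cA.
  (* For [l] other than [j], non-membership in [ultra_mem (C l)] becomes a statement about [u]-most
     [n], because [u] is an ultrafilter. *)
  have Cq l : \forall n \near u, C l n (repr q n) <-> l = j.
    have [->|lj] := eqVneq l j.
      by move/AC : Aj; apply: filterS.
    have : (~` ultra_mem (C l)) q.
      by move/AC => Al; move/eqP: lj; apply; apply: tA => //; exists q.
    rewrite ultra_memC; apply: filterS => n nCn.
    by split=> // lj'; move: lj; rewrite lj' eqxx.
  have fq : \forall n \near u, f n (repr q n) = j.
    have Cn : \forall n \near u, forall l, C l n (repr q n) <-> l = j.
      exact: filter_forall.
    apply: filterS Cn => n Cn; rewrite /f /g.
    case: pickP => [l|/(_ j)]; rewrite ffunE; first by move=> /asboolP /Cn.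
    by move=> /negP; case; apply/asboolP/Cn.
  split=> [Ai|].
    have ji : j = i by apply: (tA j i I I); exists q.
    by apply: filterS fq => n /= ->.
  (* The index is [j] for [u]-most [n] and [i] for [u]-most [n]; a common [n] forces them to
     agree. *)
  by move=> Bi; have [n /= [fj <-]] := filter_ex (filterI fq Bi); rewrite fj.
Qed.

End internal_approximation.

(** * Correlations of an ultraproduct realized in a single term *)

Section ultraproduct_approximation.
Context (G : groupType) (R : realType).
Context (u : set_system nat) (uU : UltraFilter u) (unp : forall n, ~ u [set n]).
Variable a : nat -> pmp_action G R.
Local Open Scope ereal_scope.

Let b := ultraproduct uU unp a.

(** Translation acts coordinatewise, so correlations of internal sets are measures of internal sets,
    hence [u]-limits. *)
Lemma image_ultra_mem g (B : forall n, set (a n)) :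
  (pmp_act g : b -> b) @` (ultra_mem B : set b) =
  ultra_mem (fun n => pmp_act g @` B n).
Proof.
rewrite image_pmp_act; apply/seteqP; split=> q /=.
  rewrite -[q]reprK ultra_actE => /ultra_memP Bq.
  by apply/ultra_memP; apply: filterS Bq => n; rewrite image_pmp_act.
rewrite -[q]reprK => /ultra_memP Bq; rewrite ultra_actE.
by apply/ultra_memP; apply: filterS Bq => n; rewrite image_pmp_act.
Qed.

Lemma ultraproduct_partition_approx (e : R) k (A : 'I_k -> set b)
    (F : {fset G}) :
  (0 < e)%R -> measurable_partition A ->
  exists n (B : 'I_k -> set (a n)), measurable_partition B /\
    \sum_(i < k) \sum_(j < k) \sum_(f <- F)
      `| pmp_measure b (A i `&` pmp_act f @` A j)
         - pmp_measure (a n) (B i `&` pmp_act f @` B j) | < e%:E.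
Proof.
(* [K] is the number of terms plus one, hence positive even for empty [F], and the final bound is
   strict. Each term gets [e / K], in three parts: two for [N] and its translate, one for the
   convergence along [u]. *)
move=> e0 pA; pose K : R := ((#|` F| * (k * k))%:R + 1)%R.
have K0 : (0 < K)%R by rewrite ltr_wpDl.
have d0 : (0 < e / K / 3)%R by rewrite !divr_gt0.
have [B [pB [N [mN Ne NAB]]]] : exists B : 'I_k -> forall n, set (a n),
    (forall n, measurable_partition (fun i => B i n)) /\
    exists N : set b, [/\ measurable N, pmp_measure b N <= (e / K / 3)%:E
      & forall i q, ~ N q -> (A i q <-> ultra_mem (B i) q)].
  exact: (@ultra_partition_approx _ _ uU unp _ _ (fun n => pmp_measure (a n))).
have [mA _ _] := pA.
have mB n i : measurable (B i n) by have [] := pB n.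
have near_corr i j f : \forall n \near u,
    `| pmp_measure b (A i `&` pmp_act f @` A j)
       - pmp_measure (a n) (B i n `&` pmp_act f @` B j n) | <= (e / K)%:E.
  (* Membership of [q] in the translate of [A j] is tested at the translate of [q] by the inverse of
     [f], so the translate of [N] must be avoided too. *)
  pose N' : set b := (N : set b) `|` (pmp_act f : b -> b) @` N.
  pose D n := B i n `&` pmp_act f @` B j n.
  have mD n : measurable (D n).
    by apply: measurableI => //; exact: measurable_image_pmp_act.
  pose Q : set b := ultra_mem D.
  have mQ : measurable Q by exact: measurable_ultra_mem.
  have mfA : measurable (A i `&` pmp_act f @` A j).
    by apply: measurableI => //; exact: measurable_image_pmp_act.
  have mfN : measurable ((pmp_act f : b -> b) @` N).
    exact: measurable_image_pmp_act.
  have APQ : `| pmp_measure b (A i `&` pmp_act f @` A j) - pmp_measure b Q |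
      <= pmp_measure b N'.
    apply: measure_dist_le => //; first exact: measurableU.
    move=> q N'q; rewrite /Q /D -ultra_memI -image_ultra_mem !image_pmp_act.
    have Nq : ~ N q by move=> Nq; apply: N'q; left.
    have Nfq : ~ N (pmp_act f^-1%g q).
      move=> Nfq; apply: N'q; right.
      by exists (pmp_act f^-1%g q) => //; exact: pmp_actVK.
    by split=> -[/(NAB i q Nq) ? /(NAB j _ Nfq) ?].
  have N'e : pmp_measure b N' <= (e / K / 3)%:E + (e / K / 3)%:E.
    apply: le_trans (measureU2 _ mN mfN) _.
    apply: leeD; first exact: Ne.
    by apply: le_trans Ne; rewrite -(measure_image_pmp_act f mN).
  have QL : pmp_measure b Q = ultra_lim u (fun n => pmp_measure (a n)) D.
    exact: ultra_outer_mem.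
  have := cvg_ultra_lim uU (mu := fun n => pmp_measure (a n)) mD.
  rewrite -QL -(fineK (fin_num_measure _ _ mQ)) => /fine_cvg /cvgr_dist_lt.
  move=> /(_ _ d0); apply: filterS => n Qn.
  have {}Qn : (`|fine (pmp_measure b Q) - fine (pmp_measure (a n) (D n))|
      < e / K / 3)%R := Qn.
  have := le_trans APQ N'e.
  rewrite -(fineK (fin_num_measure (pmp_measure b) _ mfA)).
  rewrite -(fineK (fin_num_measure _ _ mQ)).
  rewrite -(fineK (fin_num_measure (pmp_measure (a n)) _ (mD n))).
  rewrite -!EFinB !abse_EFin -EFinD !lee_fin => AQ.
  apply: le_trans (ler_distD (fine (pmp_measure b Q)) _ _) _.
  by apply: le_trans (lerD AQ (ltW Qn)) _; lra.
(* Taking [F] as a finite type makes this a finite intersection of members of [u], so one [n] serves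
   all terms. *)
have near_all : \forall n \near u, forall t : 'I_k * 'I_k * F,
    `| pmp_measure b (A t.1.1 `&` pmp_act (val t.2) @` A t.1.2)
       - pmp_measure (a n) (B t.1.1 n `&` pmp_act (val t.2) @` B t.1.2 n) |
    <= (e / K)%:E.
  by apply: filter_forall => t; exact: near_corr.
have [n nB] := filter_ex near_all; exists n, (fun i => B i n); split=> //.
apply: (@le_lt_trans _ _ (\sum_(i < k) \sum_(j < k) \sum_(f <- F) (e / K)%:E)).
  apply: lee_sum => i _; apply: lee_sum => j _.
  rewrite big_seq [leRHS]big_seq; apply: lee_sum => f fF.
  exact: (nB (i, j, [` fF]%fset)).
under eq_bigr do under eq_bigr do
  rewrite sumEFin big_const_seq count_predT iter_addr_0.
under eq_bigr do rewrite sumEFin sumr_const card_ord.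
rewrite sumEFin sumr_const card_ord -!mulrnA.
rewrite lte_fin -[ltLHS]mulr_natr mulrAC ltr_pdivrMr// ltr_pM2l// /K.
by rewrite ltrDl.
Qed.

End ultraproduct_approximation.

(** * Factor maps from the ultraproduct to the inverse limit and on to the finite quotients *)

Section profinite_factors.
Context (R : realType) (G : groupType) (H : nat -> groupClosed G).
Context (decH : forall n, {subset H n.+1 <= H n}).
Context (finH : forall n, finite_set [set: coset_space (H n)]).

Lemma limit_coord_factor_map n : @factor_map G R
  (profinite_action decH R finH) (coset_action R (finH n))
  (@limit_coord G H decH n).
Proof.
split=> [_ B _|//|B _]; last exact: limit_measureE.
by rewrite setTI; apply: sub_sigma_algebra; exists n, B.
Qed.

Context (u : set_system nat) (uU : UltraFilter u) (unp : forall n, ~ u [set n]).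
Let b := ultraproduct uU unp (fun n => coset_action R (finH n)).

(** Preimages of cylinders are internal, which gives measurability. Their measures are [u]-limits of
    sequences constant from [m] on, since projections preserve counting measures, and the marginals
    determine the measure. *)
Lemma exists_ultraproduct_factor_map :
  exists phi : b -> profinite_action decH R finH, factor_map phi.
Proof.
have lim_ex (q : b) m : exists c,
    \forall n \near u, coset_projection (H m) (repr q n) = c.
  exact: (ultrafilter_finite uU
    (fun n => coset_projection (H m) (repr q n)) (finH m)).
pose c q m := projT1 (cid (lim_ex q m)).
have cP q m : \forall n \near u, coset_projection (H m) (repr q n) = c q m.
  exact: projT2 (cid (lim_ex q m)).
have c_compat q : compatible (c q).
  move=> m; apply: contrapT => ncm; apply: (@filter_not_empty _ u _).
  (* Taking [n] at least [m.+1] puts [H n] inside both [H m.+1] and [H m], so that the projections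
     compose. *)
  apply: filterS3 (cP q m) (cP q m.+1) (ultrafilter_tail uU unp m.+1).
  move=> n /= cm cm1 mn; apply: ncm; rewrite -cm -cm1.
  rewrite -[repr q n]reprK (coset_projectionE (chain_subset decH mn)).
  rewrite (coset_projectionE (@decH m)).
  by rewrite (coset_projectionE (chain_subset decH (ltnW mn))).
pose phi (q : b) : profinite_action decH R finH := exist _ (c q) (c_compat q).
have phiE m B : phi @^-1` (@limit_coord _ _ decH m @^-1` B) =
    ultra_mem (fun n => coset_projection (H m) @^-1` B).
  apply/seteqP; split=> q /=.
    by move=> Bc; apply: filterS (cP q m) => n /= ->.
  move=> Bq; apply: contrapT => nBq; apply: (@filter_not_empty _ u _).
  by apply: filterS2 Bq (cP q m) => n /= + cm; rewrite cm.
have mphi : measurable_fun setT phi.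
  apply: (measurability (rT := limit_measurable decH)
    (@cylinder _ _ decH)) => //.
  move=> _ [_ [m [B ->]] <-].
  by rewrite setTI phiE; apply: ultra_mem_caratheodory.
exists phi; split=> // [g q|A mA].
  apply: limit_coord_inj => m; apply: contrapT => ncm.
  apply: (@filter_not_empty _ u _).
  (* At one common [n], both limit coordinates are attained, projection is equivariant, and the
     representative of the translated point is the translate of that of [q]. *)
  apply: filterS (filterI (filterI (cP q m) (cP (pmp_act g q) m))
    (filterI (ultrafilter_tail uU unp m)
      (ultra_repr uU (fun n => coset_act g (repr q n))))).
  move=> n /= [[cm cgm] [mn rE]]; apply: ncm.
  rewrite /limit_coord/= -[in LHS]cgm -cm.
  rewrite -(coset_projection_act (chain_subset decH mn)).
  by congr (coset_projection _ _); exact/esym.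
pose Phi : {mfun b >-> limit_measurable decH} :=
  HB.pack phi (isMeasurableFun.Build _ _ _ _ phi mphi).
apply: (@limit_marginals_unique _ _ decH R finH
  (distribution (pmp_measure b) Phi)) => // [m B|]; last exact: limit_measureE.
rewrite /distribution/= /pushforward/= phiE /ultra_measure ultra_outer_mem//.
apply: ultra_lim_near; apply: filterS (ultrafilter_tail uU unp m) => n mn.
exact: (normalized_counting_projection (chain_subset decH mn)).
Qed.

End profinite_factors.

Theorem corollary2 (R : realType) (G : groupType) (H : nat -> groupClosed G)
  (countG : countable [set: G])
  (finH : forall n, finite_set [set: coset_space (H n)])
  (decH : forall n, {subset H n.+1 <= H n})
  (u : set_system nat) (uU : UltraFilter u) (unp : forall n, ~ u [set n]) :
  weakly_equivalent
    (profinite_action decH R finH)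
    (ultraproduct uU unp (fun n => coset_action R (finH n))).
Proof.
split.
  have [phi fphi] := exists_ultraproduct_factor_map R decH finH uU unp.
  exact: factor_weakly_contained fphi.
move=> e e0 k A pA F.
have [n [B [pB ABe]]] := ultraproduct_partition_approx F e0 pA.
have fn := limit_coord_factor_map R decH finH n.
(* Pulling back along the coordinate map keeps all correlations of [B], so the error sum is
   unchanged. *)
exists (fun i => @limit_coord _ _ decH n @^-1` B i).
split; first exact: (factor_partition fn pB).
have [mB _ _] := pB; apply: le_lt_trans ABe; rewrite le_eqVlt; apply/orP; left.
apply/eqP; do 3!apply: eq_bigr => ? _.
by rewrite (factor_correlation fn).
Qed.
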